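(* Let $S=\{s_n\}_{n\in\mathbb{N}}$ be a sequence of independent and identically distributed random variables with distribution $\mathcal{R}$, where $\mathcal{R}$ has mean zero and variance one. Then the expansion paths $p_{S,W,\mathcal{R}}=\sum_{n\in\mathbb{N}}s_nw_n$ almost surely do not lie in the native Hilbert space $\mathcal{H}(C)$ of the covariance kernel $C$.
   Context: $\Omega\subset\mathbb{R}^d$ is a bounded domain and $C:\Omega\times\Omega\to\mathbb{R}$ is a continuous, symmetric, positive definite kernel with reproducing kernel Hilbert space $\mathcal{H}(C)$ of functions on $\Omega$. $W=\{w_n\}_{n\in\mathbb{N}}$ is a complete (infinite) orthonormal system of $\mathcal{H}(C)$. Functions in $\mathcal{H}(C)$ are exactly the expansions $\sum_n c_nw_n$ with $\sum_n c_n^2<\infty$, with $\|\sum_n c_nw_n\|_{\mathcal{H}(C)}^2=\sum_nc_n^2$; membership of an expansion path $\sum_n s_nw_n$ in $\mathcal{H}(C)$ is understood in terms of square summability of its coefficient sequence $S$. *)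

(* Defs.v *)
From HB Require Import structures.
From mathcomp Require Import all_boot all_order all_algebra finmap.
From mathcomp Require Import sesquilinear.
From mathcomp Require Import all_classical all_reals all_analysis.

Set Implicit Arguments.
Unset Strict Implicit.
Unset Printing Implicit Defensive.

Import Order.TTheory GRing.Theory Num.Theory.
Import numFieldNormedType.Exports.

Local Open Scope classical_set_scope.
Local Open Scope ring_scope.

Definition bounded_domain (R : realType) (d : nat) (Omega : set 'rV[R]_d) :
    Prop :=
  [/\ Omega !=set0, open Omega, connected Omega & bounded_set Omega].

(* A kernel on Omega is a function on the ambient space of which only the
   restriction to Omega x Omega matters.  The last clause is the usual one of
   the theory of reproducing kernels (nonnegative quadratic forms, repeated
   points allowed); it contains the strictly positive definite kernels. *)
Definition pd_kernel (R : realType) (d : nat) (Omega : set 'rV[R]_d)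
    (C : 'rV[R]_d -> 'rV[R]_d -> R) : Prop :=
  [/\ {within Omega `*` Omega,
        continuous (fun p : 'rV[R]_d * 'rV[R]_d => C p.1 p.2)},
      forall x y, Omega x -> Omega y -> C x y = C y x &
      forall (n : nat) (x : 'I_n -> 'rV[R]_d) (a : 'I_n -> R),
        (forall i, Omega (x i)) ->
        0 <= \sum_(i < n) \sum_(j < n) a i * a j * C (x i) (x j)].

(* H is presented as a complete normed space together with its inner product
   [ip] and the evaluation [ev f x] of its elements as functions on Omega
   ([ev f x] is junk for x outside Omega).  [rkhs_ext] says that elements of H
   are functions on Omega; with [rkhs_repr] this determines H up to the unique
   isometry commuting with evaluation (Moore-Aronszajn). *)
Record is_rkhs (R : realType) (X : Type) (Omega : set X) (C : X -> X -> R)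
    (H : completeNormedModType R) (ip : {dot H for idfun})
    (ev : H -> X -> R) : Prop := IsRkhs {
  rkhs_norm : forall f : H, `|f| ^+ 2 = ip f f ;
  rkhs_linear : forall (x : X) (a : R) (f g : H), Omega x ->
    ev (a *: f + g) x = a * ev f x + ev g x ;
  rkhs_ext : forall f g : H,
    (forall x, Omega x -> ev f x = ev g x) -> f = g ;
  rkhs_repr : forall y : X, Omega y -> exists k : H,
    (forall x, Omega x -> ev k x = C x y) /\
    (forall f : H, ip f k = ev f y) }.

Definition orthonormal_seq (R : realType) (H : completeNormedModType R)
    (ip : {dot H for idfun}) (w : nat -> H) : Prop :=
  forall m n : nat, ip (w m) (w n) = (m == n)%:R.

Definition complete_orthonormal (R : realType) (H : completeNormedModType R)
    (ip : {dot H for idfun}) (w : nat -> H) : Prop :=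
  orthonormal_seq ip w /\
  (forall f : H, (forall n, ip f (w n) = 0) -> f = 0).

Definition square_summable (R : realType) (c : R^nat) : Prop :=
  cvgn (series (fun n => c n ^+ 2)).

(* The expansion \sum_n c n *: w n lies in H, the series being taken in the norm
   of H; see [expansion_inP] for the description by the coefficients. *)
Definition expansion_in (R : realType) (H : completeNormedModType R)
    (w : nat -> H) (c : R^nat) : Prop :=
  exists f : H, series (fun n => c n *: w n) @ \oo --> f.

Lemma expansion_inP (R : realType) (H : completeNormedModType R)
    (ip : {dot H for idfun}) (w : nat -> H) (c : R^nat) :
    (forall f : H, `|f| ^+ 2 = ip f f) -> orthonormal_seq ip w ->
  expansion_in w c <-> square_summable c.
Proof.
move=> ipE wE.
have pyth m n : `|\sum_(m <= k < n) c k *: w k| ^+ 2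
    = \sum_(m <= k < n) c k ^+ 2.
  rewrite ipE linear_sumr/=.
  rewrite big_seq [RHS]big_seq; apply: eq_bigr => j jmn.
  rewrite linear_sumlz/= (bigD1_seq j) ?iota_uniq//=.
  rewrite linearZl_LR linearZr_LR/= wE eqxx mulr1 big1 ?addr0 ?expr2// => i ij.
  by rewrite linearZl_LR linearZr_LR/= wE (negbTE ij) !mulr0.
have -> : expansion_in w c <-> cvgn (series (fun n => c n *: w n)).
  split=> [[f] /cvgP//|wc]; by exists (limn (series (fun n => c n *: w n))).
rewrite /square_summable.
split=> /cauchy_cvgP/cauchy_seriesP cw; apply/cauchy_cvgP/cauchy_seriesP => e e0.
- have := cw (Num.sqrt e); rewrite sqrtr_gt0 => /(_ e0); apply: filterS => n.
  move=> /= ne; rewrite -pyth ger0_norm ?sqr_ge0//.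
  by rewrite -(sqr_sqrtr (ltW e0)) ltr_pXn2r// nnegrE// sqrtr_ge0.
- have := cw (e ^+ 2); rewrite exprn_gt0// => /(_ isT); apply: filterS => n /=.
  by rewrite -pyth ger0_norm ?sqr_ge0// ltr_pXn2r// nnegrE// ltW.
Qed.

(* Mutual independence: the product rule for every finite subfamily. *)
Definition mutually_independent (R : realType) (dT : measure_display)
    (T : measurableType dT) (P : probability T R) (S : nat -> {RV P >-> R}) :
    Prop :=
  forall (J : {fset nat}) (A : nat -> set R), (forall n, measurable (A n)) ->
    P (\bigcap_(n in [set` J]) (S n @^-1` A n)) =
    (\prod_(n <- J) P (S n @^-1` A n))%E.

Definition iid_with_law (R : realType) (dT : measure_display)
    (T : measurableType dT) (P : probability T R) (S : nat -> {RV P >-> R})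
    (Q : probability (measurableTypeR R) R) : Prop :=
  mutually_independent S /\
  forall (n : nat) (A : set R), measurable A -> distribution P (S n) A = Q A.

(* Main.v *)
Require Import Defs.
From HB Require Import structures.
From mathcomp Require Import all_boot all_order all_algebra finmap.
From mathcomp Require Import sesquilinear.
From mathcomp Require Import all_classical all_reals all_analysis.
From mathcomp Require Import measurable_realfun lra.

Set Implicit Arguments.
Unset Strict Implicit.
Unset Printing Implicit Defensive.

Import Order.TTheory GRing.Theory Num.Theory.
Import numFieldNormedType.Exports.

Local Open Scope classical_set_scope.
Local Open Scope ring_scope.

(** A square-summable sequence tends to zero, so its terms eventually stay in
    the interval A from -1/2 to 1/2. A centred random variable taking values in
    A almost surely has variance at most 1/4 ([variance_le_sqr_bound]); hence a
    law Q of mean zero and variance one satisfies [Q A < 1]. By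
    independence, k prescribed terms of the sequence all lie in A with
    probability [Q A ^+ k], which tends to zero, so that almost surely no tail
    of the sequence stays in A ([iid_tail_null]). Summing over the countably
    many tails, almost surely the coefficient sequence is not square summable,
    and by orthonormality ([expansion_inP]) the expansion then has no limit in
    the Hilbert space. *)

(** The mean being zero, the variance is the integral of [X ^+ 2], and the total
    mass is one. *)
Lemma variance_le_sqr_bound (R : realType) (d : measure_display)
    (T : measurableType d) (P : probability T R) (X : T -> R) (e : R) :
  measurable_fun setT X -> ('E_P[X] = 0)%E ->
  {ae P, forall t, `|X t| <= e} -> ('V_P[X] <= (e ^+ 2)%:E)%E.
Proof.
move=> mX X0 Xe.
rewrite /variance covariance.unlock X0 /= expectation.unlock.
have -> : (e ^+ 2)%:E = (\int[P]_(t in setT) (e ^+ 2)%:E)%E.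
  have /= -> := integral_cst P measurableT (e ^+ 2)%:E.
  by rewrite probability_setT mule1.
have sqrE t : ((X \- cst 0) * (X \- cst 0)) t = X t ^+ 2.
  by rewrite -[LHS]/((X t - 0) * (X t - 0)) subr0 expr2.
under eq_integral do rewrite sqrE.
apply: ae_ge0_le_integral => //.
- by move=> t _; rewrite lee_fin sqr_ge0.
- by apply/measurable_EFinP; exact: measurable_funX.
- by move=> t _; rewrite lee_fin sqr_ge0.
- apply: filterS Xe => t Xte _; rewrite lee_fin -real_normK ?num_real//.
  by rewrite ler_pXn2r// nnegrE// (le_trans _ Xte).
Qed.

Lemma probability1_ae (R : realType) (d : measure_display)
    (T : measurableType d) (P : probability T R) (A : set T) :
  measurable A -> P A = 1%E -> {ae P, forall t, A t}.
Proof.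
move=> mA PA; exists (~` A); split => //; first exact: measurableC.
by rewrite probability_setC// PA subee.
Qed.

(** Mutual independence speaks of finite sets of indices, whence the encoding of
    the block N, ..., N + k - 1 as a finite set enumerated by [iota N k]. *)
Lemma iid_block (R : realType) (dT : measure_display)
    (T : measurableType dT) (P : probability T R)
    (Q : probability (measurableTypeR R) R) (S : nat -> {RV P >-> R})
    (A : set R) (N k : nat) :
  iid_with_law S Q -> measurable A ->
  P (\bigcap_(n in [set n | (N <= n < N + k)%N]) (S n @^-1` A)) =
    ((fine (Q A)) ^+ k)%:E.
Proof.
move=> [indep law] mA; pose J := [fset n | n in iota N k]%fset.
have -> : [set n | (N <= n < N + k)%N] = [set` J].
  by apply/seteqP; split => n /=; rewrite !inE /= mem_iota.
rewrite (indep J (fun=> A))//.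
have -> : (\prod_(n <- J) P (S n @^-1` A) = \prod_(n <- iota N k) Q A)%E.
  transitivity (\prod_(n <- J) Q A)%E.
    by apply: eq_bigr => n _; exact: law.
  apply: perm_big; apply: uniq_perm; rewrite ?fset_uniq ?iota_uniq// => n.
  by rewrite !inE.
elim: k {J} N => [|k IH] N; first by rewrite big_nil expr0.
rewrite /= big_cons IH exprS EFinM fineK// fin_num_measure//.
Qed.

(** The tail event lies in every finite block event, so its probability is at
    most [Q A ^+ k] for every k. *)
Lemma iid_tail_null (R : realType) (dT : measure_display)
    (T : measurableType dT) (P : probability T R)
    (Q : probability (measurableTypeR R) R) (S : nat -> {RV P >-> R})
    (A : set R) (N : nat) :
  iid_with_law S Q -> measurable A -> (Q A < 1)%E ->
  P.-negligible (\bigcap_(n in [set n | (N <= n)%N]) (S n @^-1` A)).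
Proof.
move=> iidS mA QA1; set B := \bigcap_(n in _) _.
have mSA n : measurable (S n @^-1` A).
  by rewrite -[_ @^-1` _]setTI; exact: measurable_funP.
have mB : measurable B by apply: bigcap_measurableType.
exists B; split => //.
have PB k : (P B <= ((fine (Q A)) ^+ k)%:E)%E.
  rewrite -(iid_block N k iidS mA); apply: le_measure.
  - by rewrite inE.
  - by rewrite inE; apply: bigcap_measurableType.
  - by move=> t Bt n /= /andP[Nn _]; exact: Bt.
have QAfin : Q A \is a fin_num by rewrite fin_num_measure.
have PBfin : P B \is a fin_num by rewrite fin_num_measure.
have qlt1 : `|fine (Q A)| < 1.
  by rewrite ger0_norm ?fine_ge0// -lte_fin fineK.
apply/eqP; rewrite eq_le measure_ge0 andbT -(fineK PBfin) lee_fin.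
apply: (cvgr_to_ge (cvg_expr qlt1)); apply: nearW => k.
by rewrite -lee_fin fineK.
Qed.

Theorem theorem8 (R : realType) (d : nat) (Omega : set 'rV[R]_d)
    (C : 'rV[R]_d -> 'rV[R]_d -> R)
    (H : completeNormedModType R) (ip : {dot H for idfun})
    (ev : H -> 'rV[R]_d -> R) (w : nat -> H)
    (dT : measure_display) (T : measurableType dT) (P : probability T R)
    (Q : probability (measurableTypeR R) R) (S : nat -> {RV P >-> R})
    (d_gt0 : (0 < d)%N)
    (hOmega : bounded_domain Omega)
    (hC : pd_kernel Omega C)
    (hH : is_rkhs Omega C ip ev)
    (hw : complete_orthonormal ip w)
    (hmean : ('E_Q[(fun x : R => x)] = 0)%E)
    (hvar : ('V_Q[(fun x : R => x)] = 1)%E)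
    (hS : iid_with_law S Q) :
  {ae P, forall omega, ~ expansion_in w (fun n => S n omega)}.
Proof.
have normE := rkhs_norm hH; have [wE _] := hw.
(* Any radius strictly between 0 and 1 would do: below 1 to contradict the unit
   variance, positive for a null sequence to end up in the interval. *)
pose A : set R := [set x | `|x| <= 2^-1].
have mA : measurable A.
  have -> : A = [set` `[- 2^-1, 2^-1]%R].
    by apply/seteqP; split => x /=; rewrite in_itv /= -ler_norml.
  exact: measurable_itv.
have QA1 : (Q A < 1)%E.
  rewrite lt_neqAle probability_le1// andbT; apply/eqP => QA.
  have Qbnd := @probability1_ae R _ (measurableTypeR R) Q A mA QA.
  have := @variance_le_sqr_bound R _ (measurableTypeR R) Q id _
    (@measurable_id _ _ _) hmean Qbnd.
  by rewrite hvar lee_fin expr2; lra.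
apply: negligibleS (negligible_bigcup (fun N => iid_tail_null N hS mA QA1)).
move=> t /= /contrapT /(expansion_inP _ normE wE) /cvg_series_cvg_0 S2.
have : \forall n \near \oo, `|S n t ^+ 2| < 4^-1.
  by apply: (cvgr0_norm_lt _ S2); lra.
move=> [N _ NS]; exists N => // n /= Nn.
have := NS n Nn; rewrite /= normrX => lt4.
by rewrite /A /=; have := normr_ge0 (S n t); nra.
Qed.
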